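(* Let $I$ be a set of sorts and for each $i\in I$ let $(\mathcal{M}(i),R(i),\mathcal{Y}(i),\mathcal{O}(i),T_1(S)(i))$ be a framework (as defined in the context). For every $i\in I$, let $T_1(S')(i)\subseteq T_1(S)(i)$ and a partial order $P(i)$ on $\mathcal{Y}(i)$ with which $T_1(S)(i)$ is compatible be given. Assume there is some $i_0\in I$ and $t_0\in T_1(S)(i_0)\setminus T_1(S')(i_0)$ such that for every $i\in I$, $t\in T_1(S)(i)\setminus T_1(S')(i)$, and $\mu\in\mathcal{Y}(i)$ on which $t$ acts nontrivially, there exist a continuous homomorphism $v:\overline{\mathcal{M}}(i_0)\to\overline{\mathcal{M}}(i)$ which is advanceable with respect to $T_1(S')(i_0)$ and $T_1(S')(i)$, and some $\mu_0\in\mathcal{Y}(i_0)$, such that $v(\mu_0)=\mu$, $t(\mu)=v(t_0(\mu_0))$, and $v(\mathrm{DSM}(\mu_0,P(i_0)))\subseteq\mathrm{DSM}(\mu,P(i))$. If for all $i\in I$ all ambiguities of $T_1(S')(i)$ are resolvable relative to $P(i)$, and for every $\mu_0\in\mathcal{Y}(i_0)$ on which $t_0$ acts nontrivially there exists some $u_0\in T_1(S')(i_0)$ such that $t_0(\mu_0)-u_0(\mu_0)\in\mathrm{DIS}(\mu_0,P(i_0),S')$, then for all $i\in I$ all ambiguities of $T_1(S)(i)$ are resolvable relative to $P(i)$ and $\mathcal{I}(S')(i)=\mathcal{I}(S)(i)$.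
   Context: Framework of sort $i$. $\mathcal{M}(i)$ is an abelian group (written additively); $R(i)$ is a set of group endomorphisms of $\mathcal{M}(i)$. A subgroup $N$ is called an $R(i)$-module if $r(a)\in N$ for all $a\in N$, $r\in R(i)$. $\mathcal{Y}(i)\subseteq\mathcal{M}(i)$ is such that the only $R(i)$-module $N\subseteq\mathcal{M}(i)$ with $\mathcal{Y}(i)\subseteq N$ is $\mathcal{M}(i)$. $\mathcal{O}(i)=\{B_n(i)\}_{n=1}^\infty$ is a family of $R(i)$-modules in $\mathcal{M}(i)$ with $B_n(i)\supseteq B_{n+1}(i)$ and $\bigcap_nB_n(i)=\{0\}$. $\mathcal{M}(i)$ carries the group topology for which $\mathcal{O}(i)$ is a fundamental system of neighbourhoods of $0$; $\overline{\mathcal{M}}(i)\supseteq\mathcal{M}(i)$ is its completion. Group operations and elements of $R(i)$ are extended to $\overline{\mathcal{M}}(i)$ by continuity. $\mathrm{Span}(Z)$ is the smallest $R(i)$-module containing $Z\subseteq\overline{\mathcal{M}}(i)$, and $\mathrm{Cspan}(Z)$ is its closure in $\overline{\mathcal{M}}(i)$. $R^*(i)$ is the set of all finite compositions of elements of $R(i)$, including the identity; $R^*\mathcal{Y}(i)=\{r(\mu):r\in R^*(i),\mu\in\mathcal{Y}(i)\}$. $T_1(S)(i)$ is a set of continuous group homomorphisms $\overline{\mathcal{M}}(i)\to\overline{\mathcal{M}}(i)$ commuting with all elements of $R(i)$; $T(S)(i)$ is the set of all finite compositions of elements of $T_1(S)(i)$, including the identity. $S$ and $S'$ are just labels: everything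 below defined for $S$ is defined for $S'$ by replacing $T_1(S)(i)$ by $T_1(S')(i)$. A map $t$ acts nontrivially on $a$ if $t(a)\ne a$. $\mathcal{I}(S)(i)$ is the closure of $\sum_{t\in T(S)(i)}\{a-t(a):a\in\overline{\mathcal{M}}(i)\}$ in $\overline{\mathcal{M}}(i)$. ''$\nu<\mu$ in $P(i)$'' is the strict relation. $\mathrm{DSM}(\mu,P(i))=\mathrm{Cspan}(\{\nu\in\mathcal{Y}(i):\nu<\mu\text{ in }P(i)\})$. $T_1(S)(i)$ is compatible with $P(i)$ if $t(\mu)\in\{\mu\}\cup\mathrm{DSM}(\mu,P(i))$ for all $t\in T_1(S)(i)$, $\mu\in\mathcal{Y}(i)$. $\mathrm{DIS}(\mu,P(i),S)=\mathrm{Cspan}(\{\nu-t(\nu):\nu\in\mathcal{Y}(i),\nu<\mu\text{ in }P(i),t\in T_1(S)(i)\})$. An ambiguity of $T_1(S)(i)$ is a triplet $(t,\mu,u)$ with $t,u\in T_1(S)(i)$ both acting nontrivially on $\mu\in\mathcal{Y}(i)$; it is resolvable relative to $P(i)$ if $t(\mu)-u(\mu)\in\mathrm{DIS}(\mu,P(i),S)$ (for ambiguities of $T_1(S')(i)$: $\in\mathrm{DIS}(\mu,P(i),S')$). A map $v:\overline{\mathcal{M}}(j)\to\overline{\mathcal{M}}(i)$ is advanceable with respect to $T_1(S')(j)$ and $T_1(S')(i)$ if for every $t'\in T_1(S')(j)$ and $a\in R^*\mathcal{Y}(j)$ there exists $t\in T(S')(i)$ with $t(v(a))=v(t'(a))$.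 *)

(* Defs.v *)
From mathcomp Require Import all_boot all_order all_algebra.
From mathcomp Require Import all_classical all_reals all_analysis.

Set Implicit Arguments.
Unset Strict Implicit.
Unset Printing Implicit Defensive.

Import GRing.Theory.
Local Open Scope classical_set_scope.
Local Open Scope ring_scope.

Section Modules.
Context {V : zmodType}.
Implicit Types (R : set (V -> V)) (N Z : set V).

Definition subgroup N := N 0 /\ forall a b, N a -> N b -> N (a - b).

Definition rmodule R N :=
  subgroup N /\ forall r a, R r -> N a -> N (r a).

Definition Span R Z : set V := smallest (rmodule R) Z.

(* The sum of the subgroups [A j], [j] in [D]: all finite sums of elements of
   the union of the [A j]. *)
Definition sum_subgroups {J : Type} (D : set J) (A : J -> set V) : set V :=
  [set a | exists n (x : 'I_n -> V),
     (forall k, exists2 j, D j & A j (x k)) /\ a = \sum_(k < n) x k].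

End Modules.

(* All finite compositions of elements of [A], including the identity. *)
Inductive compositions {X : Type} (A : set (X -> X)) : set (X -> X) :=
| compositions_id : compositions A idfun
| compositions_comp f g : A f -> compositions A g -> compositions A (f \o g).

Definition group_cauchy {G : topologicalZmodType} (F : set_system G) :=
  forall U : set G, nbhs 0 U ->
    exists2 A, F A & forall x y, A x -> A y -> U (x - y).

(* [Mb], with [M] embedded by [e], is the completion of the topological group
   [M]: a complete Hausdorff topological group having [M] as a dense subgroup
   with the subspace topology.  It is unique up to a unique isomorphism over
   [M]. *)
Record is_completion {M Mb : topologicalZmodType} (e : M -> Mb) : Prop := {
  completion_morphism : zmod_morphism e;
  completion_inj : injective e;
  completion_nbhs : forall (a : M) (U : set M),
    nbhs a U <-> exists2 W : set Mb, nbhs (e a) W & e @^-1` W `<=` U;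
  completion_dense : dense (range e);
  completion_hausdorff : hausdorff_space Mb;
  completion_complete : forall F : set_system Mb,
    ProperFilter F -> group_cauchy F -> exists x : Mb, F --> x
}.

(* A framework without the set of maps T_1(S), which is kept as a separate
   argument below since S varies.  [fO n] is B_(n+1). *)
Record framework := Framework {
  fM : topologicalZmodType;
  fR : set (fM -> fM);
  fY : set fM;
  fO : nat -> set fM;
  fMb : topologicalZmodType;
  emb : fM -> fMb;
  fR_morphism : forall r, fR r -> zmod_morphism r;
  fY_generates : forall N, rmodule fR N -> fY `<=` N -> N = setT;
  fO_module : forall n, rmodule fR (fO n);
  fO_decr : forall n, fO n.+1 `<=` fO n;
  fO_cap : \bigcap_n fO n = [set 0];
  fO_nbhs : forall U : set fM, nbhs 0 U <-> exists n, fO n `<=` U;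
  emb_completion : is_completion emb
}.

Section Framework.
Variable F : framework.
Local Notation M := (fM F).
Local Notation Mb := (fMb F).
Local Notation e := (@emb F).

(* The elements of R, extended to the completion by continuity. *)
Definition Rbar : set (Mb -> Mb) :=
  [set g | continuous g /\ exists2 r, fR r & forall a : M, g (e a) = e (r a)].

Definition Cspan (Z : set Mb) : set Mb := closure (Span Rbar Z).

(* R^*Y, inside the completion *)
Definition RstarY : set Mb :=
  [set e (r mu) | r in compositions (@fR F) & mu in @fY F].

(* [T] is admissible as T_1(S). *)
Definition T1_axiom (T : set (Mb -> Mb)) :=
  forall t, T t -> [/\ zmod_morphism t, continuous t
    & forall r, Rbar r -> t \o r = r \o t].

Definition nontrivial (t : Mb -> Mb) (a : Mb) := t a <> a.

Definition ideal (T : set (Mb -> Mb)) : set Mb :=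
  closure (sum_subgroups (compositions T) (fun t => [set a - t a | a in setT])).

(* [le] is a partial order on the set Y; its values outside Y are irrelevant. *)
Definition partial_order_onY (le : M -> M -> Prop) :=
  [/\ forall a, fY a -> le a a,
      forall a b, fY a -> fY b -> le a b -> le b a -> a = b
    & forall a b c, fY a -> fY b -> fY c -> le a b -> le b c -> le a c].

Variable P : M -> M -> Prop.

Definition prec (nu mu : M) := [/\ fY nu, fY mu, P nu mu & nu <> mu].

Definition DSM (mu : M) : set Mb := Cspan [set e nu | nu in [set nu | prec nu mu]].

Definition compatible (T : set (Mb -> Mb)) :=
  forall t mu, T t -> fY mu -> ([set e mu] `|` DSM mu) (t (e mu)).

Definition DIS (mu : M) (T : set (Mb -> Mb)) : set Mb :=
  Cspan [set e nu - t (e nu) | nu in [set nu | prec nu mu] & t in T].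

Definition ambiguity (T : set (Mb -> Mb)) (t : Mb -> Mb) (mu : M)
    (u : Mb -> Mb) :=
  [/\ T t, T u, fY mu, nontrivial t (e mu) & nontrivial u (e mu)].

Definition resolvable (T : set (Mb -> Mb)) (t : Mb -> Mb) (mu : M)
    (u : Mb -> Mb) :=
  DIS mu T (t (e mu) - u (e mu)).

Definition all_resolvable (T : set (Mb -> Mb)) :=
  forall t mu u, ambiguity T t mu u -> resolvable T t mu u.

End Framework.

Definition advanceable (Fj Fi : framework) (v : fMb Fj -> fMb Fi)
    (Tj : set (fMb Fj -> fMb Fj)) (Ti : set (fMb Fi -> fMb Fi)) :=
  forall t' a, Tj t' -> @RstarY Fj a ->
    exists2 t, compositions Ti t & t (v a) = v (t' a).

(* Main.v *)
(* For [mu] in Y put D = DIS(mu, S').  Induction on compositions shows that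
   b - w(b) lies in D for all b in DSM(mu) and w in T(S').  If t in T_1(S) is
   not in T_1(S'), write mu = v(mu0) and t(mu) = v(t_0(mu0)), and let u_0
   satisfy t_0(mu0) - u_0(mu0) in DIS(mu0, S').  The map v need not commute with
   R, but advanceability on R^*Y turns each generator r(nu) - u(r(nu)) of
   DIS(mu0, S') into b - w(b) with b = v(r(nu)) in DSM(mu), so v sends
   DIS(mu0, S') into D, and v(u_0(mu0)) = w(mu) for some w in T(S').
   Hence every t(mu) is congruent modulo D to some w(mu) with w in T(S').  If w moves mu,
   then w(mu) is congruent to u(mu) for some u in T_1(S') moving mu, and the
   ambiguities of T_1(S') are resolvable; if w fixes mu, then mu itself lies in
   DSM(mu) and all the w'(mu), w' in T(S'), are congruent modulo D.  Finally D
   is contained in I(S'), and the ideals are determined on Y, whose closed span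
   is everything. *)
Require Import Defs.
From mathcomp Require Import all_boot all_order all_algebra.
From mathcomp Require Import all_classical all_reals all_analysis.

Set Implicit Arguments.
Unset Strict Implicit.
Unset Printing Implicit Defensive.

Import GRing.Theory.
Local Open Scope classical_set_scope.
Local Open Scope ring_scope.

(** * Additive maps, subgroups and modules over a set of maps *)

Section Morphisms.
Context {V W : zmodType} (f : V -> W).
Hypothesis fB : zmod_morphism f.

Lemma zmod_morphism0 : f 0 = 0.
Proof. by rewrite -[X in f X](subrr 0) fB subrr. Qed.

Lemma zmod_morphismN : {morph f : x / - x}.
Proof. by move=> x; rewrite -sub0r fB zmod_morphism0// sub0r. Qed.

Lemma zmod_morphismD : {morph f : x y / x + y}.
Proof.
by move=> x y; rewrite -[y in LHS]opprK fB zmod_morphismN opprK.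
Qed.

End Morphisms.

Lemma compositions1 (X : Type) (A : set (X -> X)) f : A f -> compositions A f.
Proof. by move=> Af; exact: compositions_comp Af (compositions_id A). Qed.

Section Subgroups.
Context {V W : zmodType}.
Implicit Types (f : V -> W) (N Z : set V) (R : set (V -> V)).

Lemma subgroupN N a : subgroup N -> N a -> N (- a).
Proof. by move=> [N0 NB] Na; rewrite -sub0r; exact: NB. Qed.

Lemma subgroupD N a b : subgroup N -> N a -> N b -> N (a + b).
Proof.
by move=> Ng Na Nb; rewrite -[b]opprK; apply: Ng.2 => //; exact: subgroupN.
Qed.

Lemma subgroup_sym N a b : subgroup N -> N (a - b) -> N (b - a).
Proof. by move=> Ng Nab; rewrite -opprB; exact: subgroupN. Qed.

Lemma subgroup_trans N b a c : subgroup N -> N (a - b) -> N (b - c) -> N (a - c).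
Proof. by move=> Ng ? ?; rewrite -(subrKA b); exact: subgroupD. Qed.

Lemma subgroup_subl N a b : subgroup N -> N (a - b) -> N b -> N a.
Proof. by move=> Ng ? ?; rewrite -(subrK b a); exact: subgroupD. Qed.

Lemma subgroup_preimage f (N' : set W) :
  zmod_morphism f -> subgroup N' -> subgroup (f @^-1` N').
Proof.
move=> fB N'g; split=> /=; first by rewrite zmod_morphism0//; exact: N'g.1.
by move=> a b Na Nb /=; rewrite fB; exact: N'g.2.
Qed.

Lemma rmodule_preimage R (R' : set (W -> W)) f (N' : set W) :
    zmod_morphism f ->
    (forall r, R r -> exists2 r', R' r' & f \o r =1 r' \o f) ->
  rmodule R' N' -> rmodule R (f @^-1` N').
Proof.
move=> fB fR [N'g N'R]; split; first exact: subgroup_preimage.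
by move=> r a /fR[r' R'r' frE] N'a /=; rewrite [f _]frE; exact: N'R.
Qed.

Lemma rmodule_compositions R N g a :
  rmodule R N -> compositions R g -> N a -> N (g a).
Proof. by move=> NR; elim=> //= r {}g Rr _ IH /IH; exact: NR.2. Qed.

Lemma rmodule_Span R Z : rmodule R (Span R Z).
Proof.
split; first split.
- by move=> N [] [[]].
- by move=> a b Sa Sb N NZ; apply: (NZ.1.1.2); [exact: Sa|exact: Sb].
- by move=> r a Rr Sa N NZ; apply: NZ.1.2 => //; exact: Sa.
Qed.

Lemma rmodule_sum_subgroups (J : Type) (D : set J) (A : J -> set V) R :
    (forall j a, D j -> A j a -> A j (- a)) ->
    (forall r, R r -> zmod_morphism r) ->
    (forall r j a, R r -> D j -> A j a -> A j (r a)) ->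
  rmodule R (sum_subgroups D A).
Proof.
move=> AN RB AR; split; first split.
- by exists 0%N, (fun=> 0); split; [case|rewrite big_ord0].
(* The two families are concatenated, with the second one negated. *)
- move=> _ _ [m [x [xA ->]]] [n [y [yA ->]]].
  exists (m + n)%N, 
    (fun k : 'I_(m + n) => match fintype.split k with inl i => x i | inr j => - y j end).
  split=> [k|]; first by case: fintype.split => // j; have [l ? ?] := yA j;
    exists l => //; exact: AN.
  rewrite big_split_ord/= -sumrN; congr (_ + _); apply: eq_bigr => k _.
    by case: fintype.split (unsplitK (inl k : 'I_m + 'I_n)) => //= ? [->].
  by case: fintype.split (unsplitK (inr k : 'I_m + 'I_n)) => //= ? [->].
- move=> r _ Rr [m [x [xA ->]]]; exists m, (r \o x); split=> [k|].
    by have [l ? ?] := xA k; exists l => //; exact: AR.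
  by rewrite (big_morph r (zmod_morphismD (RB r Rr)) (zmod_morphism0 (RB r Rr))).
Qed.

Lemma sum_subgroups_sub (J : Type) (D : set J) (A : J -> set V) N :
  subgroup N -> (forall j, D j -> A j `<=` N) -> sum_subgroups D A `<=` N.
Proof.
move=> Ng AN _ [n [x [xA ->]]]; elim/big_ind: _ => [|a b|k _].
- exact: Ng.1.
- exact: subgroupD.
- by have [j Dj] := xA k; exact: AN.
Qed.

Lemma subset_sum_subgroups (J : Type) (D : set J) (A : J -> set V) j :
  D j -> A j `<=` sum_subgroups D A.
Proof.
by move=> Dj a Aa; exists 1%N, (fun=> a); split; [exists j|rewrite big_ord1].
Qed.

End Subgroups.

(** * Closures and topological groups *)

Lemma closure_sub (T : topologicalType) (A B : set T) :
  closed B -> A `<=` B -> closure A `<=` B.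
Proof. by move=> ? ?; rewrite closureE; exact: smallest_sub. Qed.

Lemma closure_preimage (T U : topologicalType) (f : T -> U) (A : set T) (B : set U) :
  continuous f -> A `<=` f @^-1` B -> closure A `<=` f @^-1` closure B.
Proof.
move=> fc AB; apply: closure_sub.
  exact: (continuous_closedP _).1 fc _ (@closed_closure _ _).
by move=> x /AB/=; exact: subset_closure.
Qed.

Section TopologicalGroups.
Context {V : topologicalZmodType}.
Implicit Types (N Z U : set V) (R : set (V -> V)).

Lemma nbhsB U (a b : V) : nbhs (a - b) U ->
  exists2 A, nbhs a A & exists2 B, nbhs b B & forall x y, A x -> B y -> U (x - y).
Proof.
move=> /(@sub_continuous V (a, b))[[A B] /= [Aa Bb] AB].
by exists A => //; exists B => // x y Ax By; exact: (AB (x, y)).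
Qed.

Lemma continuous_subr (T : topologicalType) (f g : T -> V) :
  continuous f -> continuous g -> continuous (fun x => f x - g x).
Proof.
move=> fc gc x.
apply: (@continuous_comp _ _ _ (fun x => (f x, g x)) (fun x : V * V => x.1 - x.2)).
  by apply: cvg_pair => /=; [exact: fc|exact: gc].
exact: sub_continuous.
Qed.

Lemma subr_continuous (b : V) : continuous (fun a : V => a - b).
Proof. by apply: continuous_subr => a; [exact: cvg_id|exact: cvg_cst]. Qed.

Lemma addr_continuous (b : V) : continuous (fun a : V => a + b).
Proof. by move=> a; have := @subr_continuous (- b) a; rewrite opprK. Qed.

Lemma closure_rmodule R N :
  (forall r, R r -> continuous r) -> rmodule R N -> rmodule R (closure N).
Proof.
move=> Rc [[N0 NB] NR]; split; first split.
- exact: subset_closure.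
- move=> a b Na Nb U /nbhsB[A Aa [B Bb AB]].
  have [a' [? ?]] := Na _ Aa; have [b' [? ?]] := Nb _ Bb.
  by exists (a' - b'); split; [exact: NB|exact: AB].
- by move=> r a Rr; apply: closure_preimage; [exact: Rc|move=> ?; exact: NR].
Qed.

End TopologicalGroups.

Lemma eq_continuous_dense (T U : topologicalType) (A : set T) (f g : T -> U) :
    hausdorff_space U -> dense A -> continuous f -> continuous g ->
  {in A, f =1 g} -> f =1 g.
Proof.
move=> U2 Ad fc gc fg x; apply: U2 => B C Bx Cx.
have : nbhs x (f @^-1` B `&` g @^-1` C) by apply: filterI; [exact: fc|exact: gc].
rewrite nbhsE => -[G [Go Gx] GBC].
have [y [Gy Ay]] := Ad G (ex_intro _ x Gx) Go.
exists (f y); split; first exact: (GBC y Gy).1.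
by rewrite fg ?inE//; exact: (GBC y Gy).2.
Qed.

(** * Extension of endomorphisms to the completion *)

Section Completion.
Context {M Mb : topologicalZmodType} (e : M -> Mb).
Hypothesis ec : is_completion e.

Let eB : zmod_morphism e := completion_morphism ec.

Lemma completion_continuous : continuous e.
Proof. by move=> a W Wa; apply/(completion_nbhs ec); exists W. Qed.

(** An additive map continuous at 0 is uniformly continuous, so [e \o r] sends the trace on [M] of
    the neighbourhoods of a point [x] to a Cauchy filter; its limit is taken as the value at [x]. *)
Lemma completion_extend (r : M -> M) : zmod_morphism r -> continuous r ->
  exists2 g : Mb -> Mb, continuous g & forall a, g (e a) = e (r a).
Proof.
move=> rB rc.
have erc : continuous (e \o r).
  by move=> a; apply: continuous_comp; [exact: rc|exact: completion_continuous].
pose F (x : Mb) : set_system Mb :=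
  [set U | exists2 W, nbhs x W & forall a, W (e a) -> U (e (r a))].
have near_range (x : Mb) (W : set Mb) : nbhs x W -> exists a, W (e a).
  rewrite nbhsE => -[G [Go Gx] GW].
  have [y [Gy [a _ aE]]] := completion_dense ec (ex_intro _ x Gx) Go.
  by exists a; apply: GW; rewrite aE.
have FF (x : Mb) : ProperFilter (F x).
  split; [|split].
  - by move=> [W /near_range[a Wa] W0]; exact: (W0 a).
  - by exists setT => //; exact: filterT.
  - move=> A B [W Wx WA] [W' W'x W'B]; exists (W `&` W'); first exact: filterI.
    by move=> a [/WA ? /W'B ?].
  - by move=> A B AB [W Wx WA]; exists W => // a /WA/AB.
have /choice[g gP] (x : Mb) : exists y : Mb, F x --> y.
  apply: (completion_complete ec) => U U0.
  have : nbhs (0 : M) ((e \o r) @^-1` U).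
    by apply: erc; rewrite /= (zmod_morphism0 rB) (zmod_morphism0 eB).
  move=> /(completion_nbhs ec)[W]; rewrite (zmod_morphism0 eB) -(subrr x).
  move=> /nbhsB[A Ax [B Bx ABW]] WU.
  exists [set e (r a) | a in [set a | A (e a) /\ B (e a)]].
    by exists (A `&` B); [exact: filterI|move=> a AB; exists a].
  move=> _ _ [a [Aa _] <-] [b [_ Bb] <-]; rewrite -eB -rB; apply: (WU (a - b)).
  by rewrite /= eB; exact: ABW.
exists g => [x|a]; last first.
  apply: (@cvg_unique _ (completion_hausdorff ec) (F (e a))); first exact: gP.
  move=> U /(erc a)/(completion_nbhs ec)[W Wa WU]; exists W => // b; exact: WU.
(* Continuity of [g] at [x]: for [y] near [x], some [a] in [M] is close enough to both for [e (r a)]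
   to be close to [g x] and to [g y] at once. *)
move=> U Ugx.
have shift (z : Mb) (B : set Mb) : nbhs 0 B -> nbhs z [set y | B (y - z)].
  by move=> B0; have := @subr_continuous _ z z B; rewrite /= subrr; exact.
have : nbhs (0 - 0 : Mb) [set z | U (z + g x)].
  by rewrite subrr; apply: (@addr_continuous _ (g x) 0); rewrite /= add0r.
move=> /nbhsB[A A0 [B B0 ABU]].
have [W Wx WA] := gP x _ (shift _ _ A0).
apply: filterS (nbhs_interior Wx) => y Wy.
have [W' W'y W'B] := gP y _ (shift _ _ B0).
have [a [/WA Aa /W'B Ba]] := near_range _ _ (filterI Wy W'y).
by have := ABU _ _ Aa Ba; rewrite /= opprB [X in X + _]addrC subrKA subrK.
Qed.

End Completion.

(** * The action of [R] on the completion, and closed modules *)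

Section Framework.
Context {F : framework}.
Local Notation M := (fM F).
Local Notation Mb := (fMb F).
Local Notation e := (@emb F).
Local Notation Rb := (@Rbar F).
Implicit Types (N Z : set Mb) (T : set (Mb -> Mb)).

Let eP : is_completion e := @emb_completion F.

Lemma Rbar_continuous r : Rb r -> continuous r. Proof. by case. Qed.

(** Each [fO n] is stable under [r], so [r] maps the coset [a + fO n] into [r a + fO n]. *)
Lemma fR_continuous r : fR r -> continuous (r : M -> M).
Proof.
move=> Rr a U; have rB := fR_morphism Rr => Ura.
have : nbhs (0 : M) [set z | U (z + r a)].
  by apply: (@addr_continuous _ (r a) 0); rewrite /= add0r.
move=> /fO_nbhs[n BnU].
have : nbhs (a - a : M) (@fO F n) by rewrite subrr; apply/fO_nbhs; exists n.
move=> /(@subr_continuous _ a a) Bna.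
apply: (filterS (F := nbhs a) _ Bna) => x Bnx.
have /BnU/= := (fO_module F n).2 _ _ Rr Bnx.
by rewrite rB subrK.
Qed.

Lemma Rbar_extend r : fR r -> exists2 g, Rb g & forall a : M, g (e a) = e (r a).
Proof.
move=> Rr.
have [g gc gE] := completion_extend eP (fR_morphism Rr) (fR_continuous Rr).
by exists g => //; split => //; exists r.
Qed.

(* Both sides of the identity are continuous in each variable separately and
   agree on the dense subgroup [M]. *)
Lemma Rbar_morphism r : Rb r -> zmod_morphism r.
Proof.
move=> [rc [s Rs rE]].
have sB := fR_morphism Rs; have eB := completion_morphism eP.
have H2 := completion_hausdorff eP; have eD := completion_dense eP.
have comp2 (y : Mb) : continuous (fun x => r (x - y)).
  by move=> x; apply: continuous_comp; [exact: subr_continuous|exact: rc].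
have half (x : Mb) (b : M) : r (x - e b) = r x - r (e b).
  apply: (eq_continuous_dense (f := fun x => r (x - e b))
    (g := fun x => r x - r (e b)) H2 eD) x => [//||].
    by apply: continuous_subr => //; exact: cst_continuous.
  by move=> x /set_mem[a _ <-]; rewrite -eB !rE sB eB.
move=> x y.
apply: (eq_continuous_dense (f := fun y => r (x - y))
    (g := fun y => r x - r y) H2 eD) y => [y||].
- apply: (@continuous_comp _ _ _ (fun y => x - y) r); last exact: rc.
  by apply: continuous_subr y => y; [exact: cvg_cst|exact: cvg_id].
- by apply: continuous_subr => //; exact: cst_continuous.
- by move=> y /set_mem[b _ <-]; exact: half.
Qed.

Lemma Rbar_compositions_morphism g : compositions Rb g -> zmod_morphism g.
Proof. by elim=> // r {}g /Rbar_morphism rB _ gB a b; rewrite /= gB rB. Qed.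

Definition closed_module N := closed N /\ rmodule Rb N.

Lemma closed_module_Cspan Z : closed_module (Cspan Z).
Proof.
split; first exact: closed_closure.
by apply: closure_rmodule; [exact: Rbar_continuous|exact: rmodule_Span].
Qed.

Lemma subset_Cspan Z : Z `<=` Cspan Z.
Proof. by move=> x Zx; apply: subset_closure; exact: sub_gen_smallest. Qed.

Lemma Cspan_sub Z N : closed_module N -> Z `<=` N -> Cspan Z `<=` N.
Proof.
by move=> [Nc NR] ZN; apply: closure_sub => //; exact: smallest_sub.
Qed.

(** As [t] is continuous, additive and commutes with [R], the preimage of a closed module is again a
    closed module. *)
Lemma Cspan_preimage T t Z N : T1_axiom T -> T t ->
  closed_module N -> Z `<=` t @^-1` N -> Cspan Z `<=` t @^-1` N.
Proof.
move=> TP /TP[tB tc tR] [Nc NR]; apply: Cspan_sub; split.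
  exact: (continuous_closedP _).1 tc _ Nc.
apply: rmodule_preimage NR => // r Rr; exists r => // x.
by rewrite (tR r Rr).
Qed.

(** A substitute for [Cspan_sub] when [N] is not known to be stable under [R]. *)
Lemma Cspan_subgroup_sub Z N : closed N -> subgroup N ->
    (forall g z, compositions Rb g -> Z z -> N (g z)) ->
  Cspan Z `<=` N.
Proof.
move=> Nc Ng ZN; apply: closure_sub => // x Zx.
(* [N'] is the largest [R]-module contained in [N]. *)
pose N' : set Mb := [set x | forall g, compositions Rb g -> N (g x)].
suff : N' x by move=> /(_ idfun); apply; exact: compositions_id.
apply: Zx; split => [|z Zz g Rg]; last exact: ZN.
split; first split.
- by move=> g Rg; rewrite (zmod_morphism0 (Rbar_compositions_morphism Rg));
    exact: Ng.1.
- by move=> a b N'a N'b g Rg; rewrite (Rbar_compositions_morphism Rg);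
    apply: Ng.2; [exact: N'a|exact: N'b].
- move=> r a Rr N'a g Rg; apply: (N'a (g \o r)).
  elim: Rg => [|r' {}g Rr' _ IH]; last exact: compositions_comp IH.
  exact: compositions1.
Qed.

(** The span pulls back along [e] to a module containing [fY], hence to all of [M], and [M] is
    dense. *)
Lemma Cspan_fY : Cspan [set e mu | mu in @fY F] = setT.
Proof.
apply/seteqP; split => // x _.
have eT : e @^-1` Span Rb [set e mu | mu in @fY F] = setT.
  apply: fY_generates => [|mu Ymu]; last by apply: sub_gen_smallest; exists mu.
  apply: rmodule_preimage (rmodule_Span _ _); first exact: completion_morphism eP.
  by move=> r /Rbar_extend[g Rg gE]; exists g => // a; rewrite /= gE.
have eN a : Span Rb [set e mu | mu in @fY F] (e a).
  by have : setT a by []; rewrite -eT.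
move=> U; rewrite nbhsE => -[G [Go Gx] GU].
have [y [Gy [a _ aE]]] := completion_dense eP (ex_intro _ x Gx) Go.
by exists y; split; [rewrite -aE; exact: eN|exact: GU].
Qed.

Lemma RstarY_compositions g mu : compositions Rb g -> fY mu -> RstarY (g (e mu)).
Proof.
move=> + Ymu; elim=> [|r {}g [_ [s Rs rE]] _ [s' Rs' [mu' Ymu' IH]]].
  by exists idfun => //; [exact: compositions_id|exists mu].
exists (s \o s'); first exact: compositions_comp.
by exists mu' => //=; rewrite -rE IH.
Qed.

Lemma T1_axiom_compositions T : T1_axiom T -> T1_axiom (compositions T).
Proof.
move=> TP t; elim=> [|f g /TP[fB fc fR] _ [gB gc gR]]; first by split=> // x; exact: cvg_id.
split=> [a b|x|r Rr]; first by rewrite /= gB fB.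
  by apply: continuous_comp; [exact: gc|exact: fc].
by rewrite -compA gR// compA fR.
Qed.

Lemma sub_T1_axiom T T' : T' `<=` T -> T1_axiom T -> T1_axiom T'.
Proof. by move=> TT TP t /TT/TP. Qed.

(** Makes [Cspan_preimage] available for [x - t x], so that congruences between [x] and [t x] need
    checking on generators only. *)
Lemma T1_axiom_sub T : T1_axiom T -> T1_axiom [set (fun x => x - t x) | t in T].
Proof.
move=> TP _ [t /TP[tB tc tR] <-]; split=> [x y||r Rr].
- by rewrite tB !opprD addrACA.
- by apply: continuous_subr => // x; exact: cvg_id.
- apply/funext => x /=; rewrite (Rbar_morphism Rr).
  by rewrite -[t (r x)]/((t \o r) x) tR.
Qed.

(** * The ideal of a set of reductions *)

Section Ideal.
Variable T : set (Mb -> Mb).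
Hypothesis TP : T1_axiom T.

Lemma closed_module_ideal : closed_module (ideal T).
Proof.
have TsP := T1_axiom_compositions TP.
split; first exact: closed_closure.
apply: closure_rmodule; first exact: Rbar_continuous.
apply: rmodule_sum_subgroups.
- move=> t _ /TsP[tB _ _] [a _ <-]; exists (- a) => //.
  by rewrite /= (zmod_morphismN tB) opprD.
- exact: Rbar_morphism.
- move=> r t _ Rr /TsP[_ _ tR] [a _ <-]; exists (r a) => //.
  by rewrite (Rbar_morphism Rr) -[t (r a)]/((t \o r) a) tR.
Qed.

Lemma in_ideal t a : compositions T t -> ideal T (a - t a).
Proof.
move=> Tt; apply: subset_closure; apply: (subset_sum_subgroups Tt).
by exists a.
Qed.

(** Telescoping [a - f (g a)] as [(a - g a) + (g a - f (g a))] leaves single maps, and these are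
    tested on [fY] by [Cspan_fY]. *)
Lemma ideal_sub N : closed_module N ->
  (forall t mu, T t -> fY mu -> N (e mu - t (e mu))) -> ideal T `<=` N.
Proof.
move=> [Nc NR] TN; apply: closure_sub => //; apply: sum_subgroups_sub NR.1 _ => t.
elim=> [|f g Tf _ IH] _ [a _ <-]; first by rewrite subrr; exact: NR.1.1.
apply: (subgroup_trans (b := g a)) NR.1 _ _; first by apply: IH; exists a.
suff : Cspan [set e mu | mu in @fY F] `<=` (fun x => x - f x) @^-1` N.
  by rewrite Cspan_fY; exact.
apply: (Cspan_preimage (T1_axiom_sub TP)) => //; first by exists f.
by move=> _ [mu Ymu <-]; exact: TN.
Qed.

End Ideal.

(** * Reductions modulo [DIS] within one sort *)

Section Reduction.
Context {P : M -> M -> Prop}.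
Implicit Types mu nu : M.

Lemma DIS_mono T T' mu : T `<=` T' -> DIS P mu T `<=` DIS P mu T'.
Proof.
move=> TT'; apply: Cspan_sub; first exact: closed_module_Cspan.
move=> _ [nu lt_numu [t /TT' T't <-]]; apply: subset_Cspan.
by exists nu => //; exists t.
Qed.

Lemma DIS_ideal T mu : T1_axiom T -> DIS P mu T `<=` ideal T.
Proof.
move=> TP; apply: Cspan_sub; first exact: closed_module_ideal.
move=> _ [nu _ [t Tt <-]]; apply: in_ideal.
exact: compositions1.
Qed.

Hypothesis P_order : partial_order_onY P.

Lemma DSM_mono nu mu : prec P nu mu -> DSM P nu `<=` DSM P mu.
Proof.
move=> [Ynu Ymu le_numu neq_numu].
apply: Cspan_sub; first exact: closed_module_Cspan.
move=> _ [k [Yk _ le_knu neq_knu] <-]; apply: subset_Cspan; exists k => //.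
case: P_order => _ anti trans; split => //; first exact: (trans _ nu).
by move=> kmu; apply: neq_numu; apply: anti => //; rewrite -kmu.
Qed.

Variable T : set (Mb -> Mb).
Hypotheses (TP : T1_axiom T) (PT : compatible P T).

(** For a generator [nu], compatibility keeps [t nu] in [{nu}] or in [DSM nu], and the latter lies
    in [DSM mu] by transitivity. *)
Lemma DSM_T1 t mu : T t -> DSM P mu `<=` t @^-1` DSM P mu.
Proof.
move=> Tt; apply: (Cspan_preimage TP) => //; first exact: closed_module_Cspan.
move=> _ [nu lt_numu <-] /=; have [Ynu _ _ _] := lt_numu.
have [->|] := PT Tt Ynu; last exact: DSM_mono lt_numu _.
by apply: subset_Cspan; exists nu.
Qed.

Lemma DSM_compositions t mu : compositions T t -> DSM P mu `<=` t @^-1` DSM P mu.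
Proof. by elim=> // f g Tf _ IH x /IH; exact: DSM_T1. Qed.

Lemma DIS_DSM mu : DIS P mu T `<=` DSM P mu.
Proof.
apply: Cspan_sub; first exact: closed_module_Cspan.
move=> _ [nu lt_numu [t Tt <-]].
have [_ [[_ DB] _]] := @closed_module_Cspan [set e nu | nu in [set nu | prec P nu mu]].
have Dnu : DSM P mu (e nu) by apply: subset_Cspan; exists nu.
by apply: DB => //; exact: DSM_T1.
Qed.

Lemma DIS_subgroup mu : subgroup (DIS P mu T).
Proof. exact: (closed_module_Cspan _).2.1. Qed.

(** Each [x - f x] maps the generators of [DSM] to generators of [DIS]; stability of [DSM] under
    compositions lets the differences telescope. *)
Lemma DSM_DIS t mu a : compositions T t -> DSM P mu a -> DIS P mu T (a - t a).
Proof.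
move=> + Da; elim=> [|f g Tf Tg IH]; first by rewrite subrr; exact: (DIS_subgroup _).1.
apply: subgroup_trans (DIS_subgroup _) IH _.
have sub : DSM P mu `<=` (fun x => x - f x) @^-1` DIS P mu T.
  apply: (Cspan_preimage (T1_axiom_sub TP)); first by exists f.
    exact: closed_module_Cspan.
  by move=> _ [nu lt_numu <-]; apply: subset_Cspan; exists nu => //; exists f.
by apply: sub; exact: DSM_compositions.
Qed.

(** Take for [u] the first factor of [w], in order of application, that moves [mu]. The factors
    applied later act on elements of [DSM mu] and change them only modulo [DIS]. *)
Lemma compositions_reduce w mu : compositions T w -> fY mu ->
  w (e mu) = e mu \/
  exists u, [/\ T u, nontrivial u (e mu) & DIS P mu T (w (e mu) - u (e mu))].
Proof.
move=> + Ymu; elim=> [|f g Tf _ [gmu|[u [Tu umu wu]]]]; first by left.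
  rewrite /= gmu; have [|fmu] := pselect (f (e mu) = e mu); first by left.
  by right; exists f; split => //; rewrite subrr; exact: (DIS_subgroup _).1.
right; exists u; split => //; apply: (subgroup_trans (DIS_subgroup _) _ wu).
apply: (subgroup_sym (DIS_subgroup _)).
apply: (DSM_DIS (t := f)).
  exact: compositions1.
(* [g mu] lies in [DSM]: it differs from [u mu] by an element of [DIS], and [u mu] is in [DSM] by
   compatibility. *)
apply: subgroup_subl (DIS_DSM wu) _; first exact: (closed_module_Cspan _).2.1.
by case: (PT Tu Ymu).
Qed.


End Reduction.

(** Isolates the part of the argument that stays in one sort; the last hypothesis is what the
    transport along [v] has to supply. *)
Lemma all_resolvable_ideal P T T' : partial_order_onY P -> T1_axiom T ->
    T' `<=` T -> compatible P T -> all_resolvable P T' ->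
    (forall t mu, T t -> fY mu -> exists2 w, compositions T' w &
       DIS P mu T' (t (e mu) - w (e mu))) ->
  all_resolvable P T /\ ideal T' = ideal T.
Proof.
move=> P_order TP T'T PT res' red.
have T'P := sub_T1_axiom T'T TP.
have PT' : compatible P T' by move=> t mu /T'T; exact: PT.
have DISg mu := @DIS_subgroup P T' mu.
split=> [t mu u [Tt Tu Ymu tmu umu]|].
  apply: (DIS_mono T'T).
  have [w T'w tw] := red _ _ Tt Ymu; have [w' T'w' uw'] := red _ _ Tu Ymu.
  (* If [w] fixes [mu], then [t mu - mu] and [t mu] lie in [DSM mu], hence so
     does [mu], and every composition moves [mu] by an element of [DIS mu]. *)
  have fixed s x : T s -> nontrivial s (e mu) ->
      DIS P mu T' (s (e mu) - x) -> x = e mu -> DSM P mu (e mu).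
    move=> Ts smu sx <-; have DSMg := (closed_module_Cspan
      [set e nu | nu in [set nu | prec P nu mu]]).2.1.
    have : DSM P mu (s (e mu)) by case: (PT _ _ Ts Ymu).
    move=> sD; rewrite -(subKr (s (e mu)) x); apply: DSMg.2 => //.
    exact: DIS_DSM sx.
  suff ww' : DIS P mu T' (w (e mu) - w' (e mu)).
    apply: (subgroup_trans (DISg _) tw); apply: (subgroup_trans (DISg _) ww').
    exact: (subgroup_sym (DISg _)).
  have [wmu|[s [T's smu ws]]] := compositions_reduce P_order T'P PT' T'w Ymu.
    rewrite wmu; apply: (DSM_DIS P_order T'P PT' T'w').
    exact: fixed Tt tmu tw wmu.
  have [w'mu|[s' [T's' s'mu ws']]] := compositions_reduce P_order T'P PT' T'w' Ymu.
    rewrite w'mu; apply: (subgroup_sym (DISg _)).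
    by apply: (DSM_DIS P_order T'P PT' T'w); exact: fixed Tu umu uw' w'mu.
  (* Here [s] and [s'] both move [mu], so they form an ambiguity of [T']. *)
  apply: (subgroup_trans (DISg _) ws).
  apply: (subgroup_trans (b := s' (e mu)) (DISg _)); first exact: res'.
  exact: (subgroup_sym (DISg _)).
have ideal_mod := closed_module_ideal T'P.
apply/seteqP; split; apply: ideal_sub => //; first exact: closed_module_ideal.
  move=> t mu /T'T Tt Ymu; apply: in_ideal.
  exact: compositions1.
(* Both [mu - w mu] and [t mu - w mu] lie in the smaller ideal. *)
move=> t mu Tt Ymu; have [w T'w tw] := red _ _ Tt Ymu.
apply: (subgroup_trans ideal_mod.2.1 (in_ideal (a := e mu) T'w)).
apply: (subgroup_sym ideal_mod.2.1).
exact: (DIS_ideal T'P) tw.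
Qed.

End Framework.

(** * Transport between sorts *)

Lemma advanceable_DIS (F0 F : framework) (P0 : fM F0 -> fM F0 -> Prop)
    (P : fM F -> fM F -> Prop) (T0 : set (fMb F0 -> fMb F0))
    (T : set (fMb F -> fMb F)) (v : fMb F0 -> fMb F) mu0 mu :
    partial_order_onY P -> T1_axiom T0 -> T1_axiom T -> compatible P T ->
    zmod_morphism v -> continuous v -> advanceable v T0 T ->
    v @` DSM P0 mu0 `<=` DSM P mu ->
  DIS P0 mu0 T0 `<=` v @^-1` DIS P mu T.
Proof.
move=> P_order T0P TP PT vB vc vadv vDSM; apply: Cspan_subgroup_sub.
- by apply: (continuous_closedP _).1 vc _ _; exact: closed_closure.
- by apply: subgroup_preimage => //; exact: DIS_subgroup.
- move=> g _ Rg [nu lt_numu0 [t T0t <-]]; have [Ynu _ _ _] := lt_numu0.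
  (* Moving [t] outside [g] leaves it acting on [g nu], a point of [RstarY], where advanceability
     applies. *)
  have gt a : g (t a) = t (g a).
    have [_ _ tR] := T0P t T0t.
    by elim: Rg => //= r {}g Rr _ ->; rewrite -[RHS]/((t \o r) _) tR.
  rewrite /= (Rbar_compositions_morphism Rg) vB gt.
  have [w Tw <-] := vadv _ _ T0t (RstarY_compositions Rg Ynu).
  apply: DSM_DIS => //; apply: vDSM; exists (g (emb nu)) => //.
  apply: rmodule_compositions Rg _; first exact: (closed_module_Cspan _).2.
  by apply: subset_Cspan; exists nu.
Qed.

Theorem theorem6p12 (I : Type) (F : I -> framework)
    (T1S T1S' : forall i, set (fMb (F i) -> fMb (F i)))
    (P : forall i, fM (F i) -> fM (F i) -> Prop)
    (T1S_axiom : forall i, T1_axiom (T1S i))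
    (T1S'_sub : forall i, T1S' i `<=` T1S i)
    (P_order : forall i, partial_order_onY (P i))
    (T1S_compatible : forall i, compatible (P i) (T1S i))
    (i0 : I) (t0 : fMb (F i0) -> fMb (F i0))
    (t0_in : (T1S i0 `\` T1S' i0) t0)
    (shadow : forall i t mu, (T1S i `\` T1S' i) t -> fY mu ->
       nontrivial t (emb mu) ->
       exists (v : fMb (F i0) -> fMb (F i)) (mu0 : fM (F i0)),
         (zmod_morphism v /\ continuous v) /\
         advanceable v (T1S' i0) (T1S' i) /\
         fY mu0 /\
         v (emb mu0) = emb mu /\
         t (emb mu) = v (t0 (emb mu0)) /\
         v @` DSM (P i0) mu0 `<=` DSM (P i) mu)
    (S'_resolvable : forall i, all_resolvable (P i) (T1S' i))
    (t0_resolvable : forall mu0 : fM (F i0), fY mu0 ->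
       nontrivial t0 (emb mu0) ->
       exists2 u0, T1S' i0 u0 &
         DIS (P i0) mu0 (T1S' i0) (t0 (emb mu0) - u0 (emb mu0))) :
  forall i, all_resolvable (P i) (T1S i) /\ ideal (T1S' i) = ideal (T1S i).
Proof.
move=> i; have T1S'_axiom j := sub_T1_axiom (@T1S'_sub j) (@T1S_axiom j).
have compatible' : compatible (P i) (T1S' i).
  by move=> t mu /T1S'_sub; exact: T1S_compatible.
apply: all_resolvable_ideal => // t mu Tt Ymu.
have DISg := @DIS_subgroup _ (P i) (T1S' i) mu.
have [T't|T't] := pselect (T1S' i t).
  exists t; last by rewrite subrr; exact: DISg.1.
  exact: compositions1.
have [->|tmu] := pselect (t (emb mu) = emb mu).
  by exists idfun; [exact: compositions_id|rewrite subrr; exact: DISg.1].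
have [v [mu0 [[vB vc] [vadv [Ymu0 [vmu0 [tE vDSM]]]]]]] :=
  shadow i t mu (conj Tt T't) Ymu tmu.
have t0mu0 : nontrivial t0 (emb mu0) by move=> t0mu0; apply: tmu; rewrite tE t0mu0.
have [u0 T'u0 t0u0] := t0_resolvable mu0 Ymu0 t0mu0.
(* Advanceability is used at [mu0] itself, seen in [RstarY] through the empty composition. *)
have [w T'w wE] : exists2 w, compositions (T1S' i) w &
    w (v (emb mu0)) = v (u0 (emb mu0)).
  apply: vadv => //; apply: (RstarY_compositions (g := idfun)) => //.
  exact: compositions_id.
(* The difference [t mu - w mu] becomes [v (t0 mu0 - u0 mu0)]. *)
exists w => //; rewrite -{2}vmu0 wE tE -vB.
exact: advanceable_DIS vDSM _ t0u0.
Qed.
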